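(* Let $d\ge 1$, let $F=(F_1,\dots,F_k)$ be $d\times d$ positive semidefinite matrices with $\sum_{j=1}^k F_j\preceq \mathbb{I}$, let $\rho_0$ be a $d\times d$ density matrix, and let $\sigma_0=\mathbb{I}/d$. Consider the quantum iterative scaling (QIS) update map $\lambda^{(t)}\mapsto\lambda^{(t+1)}$ on $\mathbb{R}^k$ given by $$Y^{(t)}=\exp\bigl(\ln\sigma_0+\lambda^{(t)}\cdot F\bigr),\qquad \delta^{(t)}_j=\ln\langle F_j,\rho_0\rangle-\ln\bigl\langle F_j, Y^{(t)}/\operatorname{tr}Y^{(t)}\bigr\rangle,\qquad \lambda^{(t+1)}=\lambda^{(t)}+\delta^{(t)}.$$ Then the Jacobian matrix of this map at $\lambda=\lambda^{(t)}$ equals $\mathbb{I}-P^{-1}L$, where, with $\xi=\exp(\lambda\cdot F)/\operatorname{tr}\exp(\lambda\cdot F)$, $P=\sum_j \operatorname{tr}(F_j\xi)\,|j\rangle\langle j|$ is the $k\times k$ diagonal matrix of the mean values of the $F_j$ in $\xi$, and $L$ is the $k\times k$ Hessian matrix of $\lambda\mapsto\ln\operatorname{tr}\exp(\lambda\cdot F)$.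
   Context: For real $\lambda\in\mathbb{R}^k$, $\lambda\cdot F=\sum_j\lambda_jF_j$. For matrices, $\langle A,B\rangle=\operatorname{tr}(A^\dagger B)$. $A\preceq B$ means $B-A$ is positive semidefinite. The map is considered at points where all logarithms are defined (the relevant traces are positive). *)

(* Defs.v *)
From mathcomp Require Import all_boot all_order all_algebra.
From mathcomp Require Import all_classical all_reals all_analysis.
From mathcomp Require Export complex.
Import GRing.Theory Num.Theory numFieldNormedType.Exports.
Set Implicit Arguments.
Unset Strict Implicit.
Unset Printing Implicit Defensive.
Local Open Scope ring_scope.

Section QIS.
Variable R : realType.
Local Notation C := (R[i]).

Definition adjmx m n (A : 'M[C]_(m, n)) : 'M[C]_(n, m) := (map_mx conjc A)^T.

Definition hs_inner d (A B : 'M[C]_d) : C := \tr (adjmx A *m B).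

Definition psd d (A : 'M[C]_d) : Prop :=
  adjmx A = A /\ forall v : 'cV[C]_d, 0 <= (adjmx v *m A *m v) 0 0.

Definition loewner_le d (A B : 'M[C]_d) : Prop := psd (B - A).

Definition density d (rho : 'M[C]_d) : Prop := psd rho /\ \tr rho = 1.

Definition mexp_partial d (A : 'M[C]_d) (n : nat) : 'M[C]_d :=
  \sum_(m < n) ((m`!%:R)^-1 : C) *: A ^+ m.

Definition mexp d (A : 'M[C]_d) : 'M[C]_d :=
  \matrix_(i, j)
    ((limn (fun n => complex.Re (mexp_partial A n i j)))
     +i* (limn (fun n => complex.Im (mexp_partial A n i j))))%C.

Definition lincomb d k (lam : 'rV[R]_k) (F : 'I_k -> 'M[C]_d) : 'M[C]_d :=
  \sum_(j < k) ((lam 0 j)%:C)%C *: F j.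

(* sigma_0 = I/d and its matrix logarithm ln sigma_0 = ln(1/d) I
   (the logarithm of the scalar matrix I/d) *)
Definition sigma0 d : 'M[C]_d := (((d%:R : R)^-1)%:C)%C%:M.
Definition ln_sigma0 d : 'M[C]_d := ((ln ((d%:R : R)^-1))%:C)%C%:M.

Definition QIS_Y d k (F : 'I_k -> 'M[C]_d) (lam : 'rV[R]_k) : 'M[C]_d :=
  mexp (ln_sigma0 d + lincomb lam F).

Definition QIS_map d k (F : 'I_k -> 'M[C]_d) (rho0 : 'M[C]_d)
    (lam : 'rV[R]_k) : 'rV[R]_k :=
  let Y := QIS_Y F lam in
  \row_j (lam 0 j
          + (ln (complex.Re (hs_inner (F j) rho0))
             - ln (complex.Re (hs_inner (F j) ((\tr Y)^-1 *: Y))))).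

Definition xi d k (F : 'I_k -> 'M[C]_d) (lam : 'rV[R]_k) : 'M[C]_d :=
  let E := mexp (lincomb lam F) in (\tr E)^-1 *: E.

Definition QIS_P d k (F : 'I_k -> 'M[C]_d) (lam : 'rV[R]_k) : 'M[R]_k :=
  diag_mx (\row_j complex.Re (\tr (F j *m xi F lam))).

Definition logZ d k (F : 'I_k -> 'M[C]_d) (lam : 'rV[R]_k) : R :=
  ln (complex.Re (\tr (mexp (lincomb lam F)))).

Definition hessian k (g : 'rV[R]_k -> R) (lam : 'rV[R]_k) : 'M[R]_k :=
  \matrix_(i, l)
    ('D_(delta_mx 0 l) (fun mu => 'D_(delta_mx 0 i) g mu) lam).

End QIS.

(* Main.v *)
From HB Require Import structures.
Require Import Defs.
From mathcomp Require Import all_boot all_order all_algebra.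
From mathcomp Require Import all_classical all_reals all_analysis.
From mathcomp Require Import complex spectral.
From mathcomp Require Import ring lra.
Import ComplexField.Normc.
Import Order.TTheory GRing.Theory Num.Theory numFieldNormedType.Exports.
Set Implicit Arguments.
Unset Strict Implicit.
Unset Printing Implicit Defensive.
Local Open Scope ring_scope.

(* Write E(lambda) = exp(lambda . F) and Z = tr E. Since ln sigma_0 is a scalar
   matrix, Y / tr Y = E / Z = xi, so the update is
   lambda_j + ln <F_j, rho_0> - ln p_j with p_j = tr (F_j xi). By cyclicity of
   the trace d_j Z = tr (F_j E), hence p_j = d_j ln Z for every lambda, and
   d_l p_j is the (j, l) entry of the Hessian L. Differentiating the update thus
   gives delta_jl - L_jl / p_j. That lambda |-> tr (G E(lambda)) is
   differentiable follows from the power series: the terms of (A + H)^n that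
   are at least quadratic in H have norm at most n^2 |1| |H|^2 r^n as soon as
   r >= 1 and r >= |A| + |H|, which is summable against 1 / n!. Hermitian
   matrices being diagonalizable, Z is a positive real and
   exp (c I + A) = e^c exp A. *)

(** * Real series with terms weighted by inverse factorials *)

Section FactorialSeries.
Variable R : realType.
Implicit Types (u v : nat -> R) (K r : R).

Definition fact_series u : nat -> R := series (fun n => u n / n`!%:R).

Section Bounded.
Context {u K r} (ur : forall n, `|u n| <= K * r ^+ n) (r_ge0 : 0 <= r).

Let K_ge0 : 0 <= K.
Proof. by have := ur 0; rewrite expr0 mulr1; apply: le_trans. Qed.

Let norm_le n : `|u n / n`!%:R| <= K * exp_coeff r n.
Proof.
rewrite normrM normfV [X in _ / X]ger0_norm ?ler0n// /exp_coeff mulrA.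
by rewrite ler_wpM2r ?invr_ge0 ?ler0n.
Qed.

Let cvg_normed : cvgn [normed series (fun n => u n / n`!%:R)].
Proof.
apply: (@series_le_cvg _ _ (fun n => K * exp_coeff r n)) => //.
- by move=> n; exact: normr_ge0.
- by move=> n; rewrite mulr_ge0// exp_coeff_ge0.
- exact: is_cvg_seriesZ (is_cvg_series_exp_coeff r).
Qed.

Lemma is_cvg_fact_series : cvgn (fact_series u).
Proof. exact: normed_cvg. Qed.

(** Domination by [K] times the exponential series of [r]. This turns termwise estimates on matrix
    powers into an estimate on the exponential. *)
Lemma norm_lim_fact_series : `|limn (fact_series u)| <= K * expR r.
Proof.
apply: le_trans (lim_series_norm cvg_normed) _.
have -> : K * expR r = limn (series (K *: exp_coeff r)).
  by rewrite lim_seriesZ//; exact: is_cvg_series_exp_coeff.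
apply: ler_lim => //.
- exact: is_cvg_seriesZ (is_cvg_series_exp_coeff r).
- by apply: nearW => n; apply: ler_sum => i _; exact: norm_le.
Qed.

End Bounded.

Lemma fact_seriesB u v : fact_series (u \- v) = fact_series u - fact_series v.
Proof.
apply/funext => n; rewrite fctE /fact_series /series/= -sumrB.
by apply: eq_bigr => i _; rewrite mulrBl.
Qed.

End FactorialSeries.

(** * Real trace functionals, an entrywise norm, and first-order expansion of matrix powers *)

Section TraceFunctional.
Variable R : realType.
Local Notation C := R[i].
Variable d : nat.
Implicit Types (A B H G : 'M[C]_d) (x : R).

Lemma ReD (a b : C) : complex.Re (a + b) = complex.Re a + complex.Re b.
Proof. by case: a => ? ?; case: b. Qed.

Lemma ReZ x (a : C) : complex.Re (x%:C%C * a) = x * complex.Re a.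
Proof. by case: a => a b /=; rewrite mul0r subr0. Qed.

Lemma Re_sum (I : Type) (s : seq I) (P : pred I) (E : I -> C) :
  complex.Re (\sum_(i <- s | P i) E i) = \sum_(i <- s | P i) complex.Re (E i).
Proof. exact: (big_morph _ ReD). Qed.

(** Real and imaginary parts of entries are all of this form, so limits of complex matrices reduce
    to limits of real numbers, one for each test matrix [G]. *)
Definition rtr G A : R := complex.Re (\tr (G *m A)).

Lemma rtrD G A B : rtr G (A + B) = rtr G A + rtr G B.
Proof. by rewrite /rtr mulmxDr linearD/= ReD. Qed.

Lemma rtrZ G x A : rtr G (x%:C%C *: A) = x * rtr G A.
Proof. by rewrite /rtr -scalemxAr linearZ/= ReZ. Qed.

Lemma rtrN G A : rtr G (- A) = - rtr G A.
Proof.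
by rewrite -scaleN1r -(rmorph1 (real_complex R)) -rmorphN rtrZ mulN1r.
Qed.

Lemma rtrB G A B : rtr G (A - B) = rtr G A - rtr G B.
Proof. by rewrite rtrD rtrN. Qed.

Lemma rtr_sum G (I : Type) (s : seq I) (P : pred I) (E : I -> 'M[C]_d) :
  rtr G (\sum_(i <- s | P i) E i) = \sum_(i <- s | P i) rtr G (E i).
Proof.
by apply: (big_morph (rtr G)) => [A B|];
  rewrite /rtr ?mulmx0 ?linear0//; exact: rtrD.
Qed.

(** The entrywise l1 norm, real-valued and submultiplicative. The identity has norm [d], which is
    why a factor [nrm 1] runs through the bounds on powers. *)
Definition nrm A : R := \sum_i \sum_j normc (A i j).

Lemma normc_ge0 (z : C) : 0 <= normc z.
Proof. by case: z => a b; rewrite sqrtr_ge0. Qed.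

Lemma normc_real x : normc (x%:C)%C = `|x|.
Proof. by rewrite /= expr0n/= addr0 sqrtr_sqr. Qed.

Lemma Re_le_normc (z : C) : `|complex.Re z| <= normc z.
Proof.
by case: z => a b /=; rewrite -sqrtr_sqr ler_wsqrtr// lerDl sqr_ge0.
Qed.

Lemma normc_sum (I : Type) (s : seq I) (P : pred I) (E : I -> C) :
  normc (\sum_(i <- s | P i) E i) <= \sum_(i <- s | P i) normc (E i).
Proof.
elim/big_ind2 : _ => [|x y z t xy zt|//]; first by rewrite normc0.
by apply: le_trans (le_normcD _ _) _; rewrite lerD.
Qed.

Lemma nrm_ge0 A : 0 <= nrm A.
Proof. by do 2!apply: sumr_ge0 => ? _; exact: normc_ge0. Qed.

Lemma nrmD A B : nrm (A + B) <= nrm A + nrm B.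
Proof.
rewrite /nrm -big_split/=; apply: ler_sum => i _.
rewrite -big_split/=; apply: ler_sum => j _; rewrite mxE; exact: le_normcD.
Qed.

Lemma nrmZ x A : nrm (x%:C%C *: A) = `|x| * nrm A.
Proof.
rewrite /nrm mulr_sumr; apply: eq_bigr => i _.
by rewrite mulr_sumr; apply: eq_bigr => j _; rewrite mxE normcM normc_real.
Qed.

Lemma nrm0 : nrm 0 = 0.
Proof.
by rewrite /nrm big1// => i _; rewrite big1// => j _; rewrite mxE normc0.
Qed.

(** After the sums are exchanged, each entry of [A] is multiplied by one row sum of [B], and a row
    sum is at most [nrm B]. *)
Lemma nrmM A B : nrm (A * B) <= nrm A * nrm B.
Proof.
rewrite {2}/nrm mulr_suml /nrm; apply: ler_sum => i _; rewrite -/(nrm B).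
apply: (@le_trans _ _ (\sum_j \sum_l normc (A i l) * normc (B l j))).
  apply: ler_sum => j _; rewrite mxE; apply: le_trans (normc_sum _ _ _) _.
  by apply: ler_sum => l _; rewrite normcM.
rewrite exchange_big/= mulr_suml; apply: ler_sum => l _.
rewrite -mulr_sumr ler_wpM2l ?normc_ge0// /nrm [leRHS](bigD1 l)//= lerDl.
by do 2!apply: sumr_ge0 => ? _; exact: normc_ge0.
Qed.

Lemma norm_rtr G A : `|rtr G A| <= nrm G * nrm A.
Proof.
apply: le_trans (Re_le_normc _) _; apply: le_trans (nrmM G A).
apply: le_trans (normc_sum _ _ _) _; apply: ler_sum => i _.
by rewrite (bigD1 i)//= lerDl; apply: sumr_ge0 => ? _; exact: normc_ge0.
Qed.

Lemma nrmX A r n : nrm A <= r -> nrm (A ^+ n) <= nrm 1 * r ^+ n.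
Proof.
move=> Ar; elim: n => [|n IHn]; first by rewrite !expr0 mulr1.
rewrite !exprSr mulrA; apply: le_trans (nrmM _ _) _.
by apply: ler_pM => //; exact: nrm_ge0.
Qed.

(* The part of [(A + H) ^+ n] that is linear in [H]. *)
Fixpoint dpow A H n : 'M[C]_d :=
  if n is m.+1 then dpow A H m * A + A ^+ m * H else 0.

Section PowerExpansion.
Context {A H : 'M[C]_d} {r : R}.
Hypotheses (r_ge1 : 1 <= r) (AHr : nrm A + nrm H <= r).

Let r_ge0 : 0 <= r. Proof. by rewrite (le_trans ler01). Qed.

Let Ar : nrm A <= r.
Proof. by apply: le_trans AHr; rewrite lerDl nrm_ge0. Qed.

Let AHr' : nrm (A + H) <= r.
Proof. exact: le_trans (nrmD _ _) AHr. Qed.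

(** The linear part ([B = A]) and the full increment of the power ([B = A + H]) obey the same
    recursion, so one induction bounds both. *)
Lemma nrm_pow_recurrence B (X : nat -> 'M[C]_d) n :
  nrm B <= r -> X 0 = 0 -> (forall n, X n.+1 = X n * B + A ^+ n * H) ->
  nrm (X n) <= n%:R * nrm 1 * nrm H * r ^+ n.
Proof.
move=> Br X0 XS; elim: n => [|n IHn]; first by rewrite X0 nrm0 !mul0r.
rewrite XS; apply: le_trans (nrmD _ _) _.
have h1 : nrm (X n * B) <= n%:R * nrm 1 * nrm H * r ^+ n * r.
  by apply: le_trans (nrmM _ _) _; apply: ler_pM => //; exact: nrm_ge0.
have h2 : nrm (A ^+ n * H) <= nrm 1 * r ^+ n * nrm H.
  apply: le_trans (nrmM _ _) _.
  by apply: ler_wpM2r; [exact: nrm_ge0 | exact: nrmX].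
(* Here [r >= 1] raises the exponent to [n.+1], so that the new term has the same shape as the
   inductive one. *)
have h3 : nrm 1 * r ^+ n * nrm H <= nrm 1 * r ^+ n * nrm H * r.
  by rewrite ler_peMr// !mulr_ge0 ?nrm_ge0 ?exprn_ge0.
apply: le_trans (lerD h1 (le_trans h2 h3)) _.
by rewrite -natr1 exprSr le_eqVlt; apply/orP; left; apply/eqP; ring.
Qed.

Lemma nrm_dpow n : nrm (dpow A H n) <= n%:R * nrm 1 * nrm H * r ^+ n.
Proof. exact: (nrm_pow_recurrence (X := dpow A H) n Ar). Qed.

Lemma nrm_powB n : nrm ((A + H) ^+ n - A ^+ n) <= n%:R * nrm 1 * nrm H * r ^+ n.
Proof.
apply: (nrm_pow_recurrence (X := fun n => (A + H) ^+ n - A ^+ n) n AHr').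
  by rewrite subrr.
by move=> m; rewrite !exprSr !mulrBl !mulrDr opprD -!addrA addNr addr0.
Qed.

(** The remainder at [n.+1] is the remainder at [n] times [A], plus the increment of the [n]-th
    power times [H]. That increment is already of order [nrm H], so the added term is quadratic. *)
Lemma nrm_pow_remainder n :
  nrm ((A + H) ^+ n - A ^+ n - dpow A H n) <=
  n%:R ^+ 2 * nrm 1 * nrm H ^+ 2 * r ^+ n.
Proof.
elim: n => [|n IHn] /=.
  by rewrite subrr subr0 nrm0 expr0n/= !mul0r.
have -> : (A + H) ^+ n.+1 - A ^+ n.+1 - (dpow A H n * A + A ^+ n * H) =
    ((A + H) ^+ n - A ^+ n - dpow A H n) * A + ((A + H) ^+ n - A ^+ n) * H.
  rewrite !exprSr !mulrBl !mulrDr !opprD -!addrA; congr (_ + _).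
  by rewrite [LHS]addrCA; congr (_ + _); rewrite [LHS]addrCA.
apply: le_trans (nrmD _ _) _.
have h1 : nrm (((A + H) ^+ n - A ^+ n - dpow A H n) * A) <=
    n%:R ^+ 2 * nrm 1 * nrm H ^+ 2 * r ^+ n * r.
  by apply: le_trans (nrmM _ _) _; apply: ler_pM => //; exact: nrm_ge0.
have h2 : nrm (((A + H) ^+ n - A ^+ n) * H) <=
    n%:R * nrm 1 * nrm H * r ^+ n * nrm H.
  apply: le_trans (nrmM _ _) _.
  by apply: ler_wpM2r; [exact: nrm_ge0 | exact: nrm_powB].
have K0 : 0 <= nrm 1 * nrm H ^+ 2 * r ^+ n.
  by rewrite !mulr_ge0 ?exprn_ge0 ?nrm_ge0.
set K := nrm 1 * nrm H ^+ 2 * r ^+ n in K0.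
have -> : n.+1%:R ^+ 2 * nrm 1 * nrm H ^+ 2 * r ^+ n.+1 = n.+1%:R ^+ 2 * K * r.
  by rewrite (exprSr r) /K; ring.
have h1' : n%:R ^+ 2 * nrm 1 * nrm H ^+ 2 * r ^+ n * r = n%:R ^+ 2 * K * r.
  by rewrite /K; ring.
have h2' : n%:R * nrm 1 * nrm H * r ^+ n * nrm H = n%:R * K.
  by rewrite /K; ring.
rewrite h1' in h1; rewrite h2' in h2.
apply: le_trans (lerD h1 h2) _.
have hn : (0 : R) <= n%:R by rewrite ler0n.
have h3 : n%:R * K <= n%:R * K * r by rewrite ler_peMr// mulr_ge0.
apply: le_trans (lerD (lexx _) h3) _.
(* What remains is [n ^ 2 + n <= (n + 1) ^ 2]. *)
rewrite -!mulrDl; do 2!apply: ler_wpM2r => //.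
by rewrite -natr1; nra.
Qed.

End PowerExpansion.

End TraceFunctional.

(** * The matrix exponential under trace functionals, and its directional derivative *)

Section ExponentialFunctional.
Local Open Scope classical_set_scope.
Variable R : realType.
Local Notation C := R[i].
Variable d : nat.
Implicit Types (A B H G : 'M[C]_d) (x : R).

Lemma cvg_sum_fin (T : Type) (Fl : set_system T) (I : Type) (s : seq I)
    (u : I -> T -> R) (l : I -> R) : Filter Fl ->
  (forall i, u i x @[x --> Fl] --> l i) ->
  \sum_(i <- s) u i x @[x --> Fl] --> \sum_(i <- s) l i.
Proof.
move=> FF ul; elim: s => [|i s IHs].
  by under eq_fun do rewrite big_nil; rewrite big_nil; exact: cvg_cst.
by under eq_fun do rewrite big_cons; rewrite big_cons; exact: cvgD.
Qed.

Lemma tr_delta_mx A i j : \tr (delta_mx j i *m A) = A i j.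
Proof.
rewrite /mxtrace (bigD1 j)//= big1 => [|k /negPf kj]; last first.
  by rewrite mxE big1// => l _; rewrite mxE kj mul0r.
rewrite addr0 mxE (bigD1 i)//= big1 => [|l /negPf li]; last first.
  by rewrite mxE li andbF mul0r.
by rewrite mxE !eqxx mul1r addr0.
Qed.

Lemma Re_entry A i j : complex.Re (A i j) = rtr (delta_mx j i) A.
Proof. by rewrite /rtr tr_delta_mx. Qed.

Lemma Im_entry A i j : complex.Im (A i j) = rtr (- 'i%C *: delta_mx j i) A.
Proof.
rewrite /rtr -scalemxAl linearZ/= tr_delta_mx.
by case: (A i j) => a b /=; rewrite !mulNr mul0r mul1r oppr0 opprK add0r.
Qed.

(** Testing against elementary matrices, and these times [- 'i], recovers the real and imaginary
    parts of every entry. *)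
Lemma rtr_inj A B : (forall G, rtr G A = rtr G B) -> A = B.
Proof.
move=> AB; apply/matrixP => i j; apply/eqP.
by rewrite eq_complex !Re_entry !Im_entry !AB !eqxx.
Qed.

Lemma rtr_entries G A : rtr G A = \sum_i \sum_j
  (complex.Re (G i j) * complex.Re (A j i) -
   complex.Im (G i j) * complex.Im (A j i)).
Proof.
rewrite /rtr Re_sum; apply: eq_bigr => i _; rewrite mxE Re_sum.
by apply: eq_bigr => j _; case: (G i j) (A j i) => a b [].
Qed.

Lemma rtr_mexp_partial G A n :
  rtr G (mexp_partial A n) = fact_series (fun m => rtr G (A ^+ m)) n.
Proof.
rewrite rtr_sum /fact_series /series/= big_mkord; apply: eq_bigr => m _.
rewrite mulrC -rtrZ; congr (rtr G (_ *: _)).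
by rewrite fmorphV rmorph_nat.
Qed.

Lemma is_cvg_rtr_pow G A : cvgn (fact_series (fun n => rtr G (A ^+ n))).
Proof.
apply: (@is_cvg_fact_series _ _ (nrm G * nrm (1 : 'M[C]_d)) (nrm A));
  last exact: nrm_ge0.
move=> n; apply: le_trans (norm_rtr _ _) _; rewrite -mulrA.
by apply: ler_wpM2l; [exact: nrm_ge0 | exact: nrmX].
Qed.

(** [mexp] is built from [limn], which is meaningful only once convergence is known. Each real or
    imaginary entry is a trace functional, hence a convergent factorial series; finite sums then
    give any [G]. *)
Lemma cvg_rtr_mexp_partial G A :
  rtr G (mexp_partial A n) @[n --> \oo] --> rtr G (mexp A).
Proof.
under eq_fun do rewrite rtr_entries.
rewrite rtr_entries; apply: cvg_sum_fin => i; apply: cvg_sum_fin => j.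
have cv (u : R ^nat) H : (u = fun n => rtr H (mexp_partial A n)) ->
    u n @[n --> \oo] --> limn u.
  move=> ->; under eq_fun do rewrite rtr_mexp_partial.
  exact: is_cvg_rtr_pow.
rewrite [mexp A j i]mxE /=; apply: cvgB; apply: cvgMr; apply: cv.
- by apply/funext => n; exact: Re_entry.
- by apply/funext => n; exact: Im_entry.
Qed.

Lemma cvg_rtr_mexp G A :
  fact_series (fun n => rtr G (A ^+ n)) @ \oo --> rtr G (mexp A).
Proof.
have := @cvg_rtr_mexp_partial G A.
by under eq_fun do rewrite rtr_mexp_partial.
Qed.

(** The derivative at [A] in direction [H] of the exponential tested against [G], obtained by
    differentiating the power series term by term. *)
Definition dexp G A H : R := limn (fact_series (fun n => rtr G (dpow A H n))).

(** Absorbs the polynomial factors [n] and [n ^ 2] into a geometric one, so that the bounds fit the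
    form [K * r ^+ n] with [4 * r] for [r]. *)
Lemma natr_le_exp4 n : (n%:R : R) ^+ 2 <= 4 ^+ n.
Proof.
rewrite -!natrX ler_nat -[4%N]/(2 ^ 2)%N -expnM mulnC expnM.
by rewrite leq_exp2r// ltnW// ltn_expl.
Qed.

Lemma is_cvg_dexp G A H : cvgn (fact_series (fun n => rtr G (dpow A H n))).
Proof.
pose r := 1 + (nrm A + nrm H).
have r_ge1 : 1 <= r by rewrite lerDl addr_ge0 ?nrm_ge0.
have AHr : nrm A + nrm H <= r by rewrite lerDr.
have r_ge0 : 0 <= r by rewrite (le_trans ler01).
have ur n : `|rtr G (dpow A H n)| <=
    nrm G * (nrm (1 : 'M[C]_d) * nrm H) * (4 * r) ^+ n.
  apply: le_trans (norm_rtr _ _) _; rewrite -mulrA ler_wpM2l ?nrm_ge0//.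
  apply: le_trans (nrm_dpow r_ge1 AHr n) _.
  rewrite exprMn.
  rewrite [leRHS](_ : _ = 4 ^+ n * (nrm (1 : 'M[C]_d) * (nrm H * r ^+ n))).
    rewrite -!mulrA ler_wpM2r ?mulr_ge0 ?nrm_ge0 ?exprn_ge0//.
    (* The linear factor is handled through [n <= n ^ 2 <= 4 ^ n]. *)
    apply: le_trans (natr_le_exp4 n); rewrite -natrX ler_nat -mulnn.
    by case: (n) => // m; rewrite leq_pmull.
  by ring.
by apply: (is_cvg_fact_series ur); rewrite mulr_ge0.
Qed.

(** Assuming [nrm H <= 1] allows [r = nrm A + 1], independent of [H]; the constant in front of
    [nrm H ^+ 2] is then uniform in [H]. *)
Lemma dexp_remainder G A H : nrm H <= 1 ->
  `|rtr G (mexp (A + H)) - rtr G (mexp A) - dexp G A H| <=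
  nrm G * nrm (1 : 'M[C]_d) * expR (4 * (nrm A + 1)) * nrm H ^+ 2.
Proof.
move=> H1; pose r := nrm A + 1.
have r_ge1 : 1 <= r by rewrite lerDr nrm_ge0.
have AHr : nrm A + nrm H <= r by rewrite lerD2l.
have r_ge0 : 0 <= r by rewrite (le_trans ler01).
pose u n := rtr G ((A + H) ^+ n - A ^+ n - dpow A H n).
have ur n : `|u n| <= nrm G * nrm (1 : 'M[C]_d) * nrm H ^+ 2 * (4 * r) ^+ n.
  apply: le_trans (norm_rtr _ _) _; rewrite -!mulrA ler_wpM2l ?nrm_ge0//.
  apply: le_trans (nrm_pow_remainder r_ge1 AHr n) _.
  rewrite exprMn.
  rewrite [leRHS](_ : _ = 4 ^+ n * (nrm (1 : 'M[C]_d) * (nrm H ^+ 2 * r ^+ n))).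
    rewrite -[leLHS]mulrA -[leLHS]mulrA.
    apply: ler_wpM2r; last exact: natr_le_exp4.
    by rewrite ?mulr_ge0 ?nrm_ge0 ?exprn_ge0 ?nrm_ge0.
  by ring.
have -> : rtr G (mexp (A + H)) - rtr G (mexp A) - dexp G A H =
    limn (fact_series u).
  apply/esym/cvg_lim => //.
  have -> : fact_series u = fact_series (fun n => rtr G ((A + H) ^+ n)) -
      fact_series (fun n => rtr G (A ^+ n)) -
      fact_series (fun n => rtr G (dpow A H n)).
    rewrite -!fact_seriesB; congr fact_series; apply/funext => n.
    by rewrite /u !rtrB.
  apply: cvgB; last exact: is_cvg_dexp.
  by apply: cvgB; exact: cvg_rtr_mexp.
apply: le_trans (norm_lim_fact_series ur _) _; first by rewrite mulr_ge0.
by rewrite mulrAC.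
Qed.

Lemma dpow_lincomb k (h : 'rV[R]_k) (F : 'I_k -> 'M[C]_d) A n :
  dpow A (lincomb h F) n = lincomb h (fun j => dpow A (F j) n).
Proof.
elim: n => [|n IHn] /=.
  by rewrite /lincomb big1// => j _; rewrite scaler0.
rewrite IHn /lincomb mulr_suml mulr_sumr -big_split/=; apply: eq_bigr => j _.
by rewrite scalerDr; congr (_ + _);
  [exact/esym/scalemxAl | exact/esym/scalemxAr].
Qed.

Lemma dexp_lincomb k (h : 'rV[R]_k) (F : 'I_k -> 'M[C]_d) G A :
  dexp G A (lincomb h F) = \sum_j h 0 j * dexp G A (F j).
Proof.
apply: cvg_lim => //.
have -> : fact_series (fun n => rtr G (dpow A (lincomb h F) n)) =
    fun n => \sum_j (h 0 j) * fact_series (fun n => rtr G (dpow A (F j) n)) n.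
  apply/funext => n; rewrite /fact_series /series/=.
  under [RHS]eq_bigr do rewrite mulr_sumr.
  rewrite exchange_big/=; apply: eq_bigr => m _.
  rewrite dpow_lincomb rtr_sum mulr_suml; apply: eq_bigr => j _.
  by rewrite rtrZ mulrA.
by apply: cvg_sum_fin => j; apply: cvgMr; exact: is_cvg_dexp.
Qed.

(** [dpow A H n] is the sum of the [n] products [A ^ i H A ^ (n - 1 - i)], which cyclicity makes
    equal under the trace. The extra factor [A ^+ m] carries the induction; for [n = 0] both sides
    are zero, so the truncated predecessor is harmless. *)
Lemma tr_dpow A H n m :
  \tr (dpow A H n * A ^+ m) = \tr (H *m A ^+ (n + m).-1) *+ n.
Proof.
elim: n m => [|n IHn] m /=; first by rewrite mul0r mxtrace0.
rewrite mulrDl mxtraceD -mulrA -exprS IHn addnS/= mulrS [LHS]addrC.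
congr (_ + _); rewrite -mulrA [LHS]mxtrace_mulC -mulmxA.
by rewrite -[A ^+ m *m _]/(A ^+ m * A ^+ n) -exprD addnC.
Qed.

Lemma ReMn (z : C) n : complex.Re (z *+ n) = complex.Re z *+ n.
Proof. by elim: n => // n IHn; rewrite !mulrS ReD IHn. Qed.

(** For [G = 1] the term of index [m.+1] is [m.+1] times the trace of [H A ^ m] over [m.+1]
    factorial, which is the term of index [m] in the series for [rtr H (mexp A)]. *)
Lemma dexp_trace A H : dexp 1 A H = rtr H (mexp A).
Proof.
apply: cvg_lim => //; rewrite -cvg_shiftS.
rewrite (_ : (fun n => _) = fact_series (fun n => rtr H (A ^+ n))).
  exact: cvg_rtr_mexp.
(* The term of index 0 vanishes since [dpow A H 0 = 0]; this pays for the shift of index. *)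
apply/funext => n; rewrite /fact_series /series/= big_nat_recl//=.
rewrite {1}/rtr mulmx0 mxtrace0 mul0r add0r; apply: eq_bigr => m _.
rewrite -[dpow A H m * A + A ^+ m * H]/(dpow A H m.+1).
have -> : rtr 1 (dpow A H m.+1) = rtr H (A ^+ m) * m.+1%:R.
  rewrite /rtr mul1mx -[dpow A H m.+1]mulr1 -(expr0 A) tr_dpow addn0/=.
  by rewrite ReMn mulr_natr.
rewrite factS natrM invfM mulrA mulfK// pnatr_eq0//.
Qed.

End ExponentialFunctional.

(** * Exponentials of Hermitian matrices by diagonalization *)

Section HermitianExponential.
Local Open Scope classical_set_scope.
Variable R : realType.
Local Notation C := R[i].
Variable d : nat.
Implicit Types (A : 'M[C]_d) (a : 'rV[R]_d).

(** The eigenvalues are kept as a real row, so that the real exponential applies to them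
    directly. *)
Definition conj_diag (U : 'M[C]_d) a : 'M[C]_d :=
  invmx U *m diag_mx (map_mx (real_complex R) a) *m U.

Lemma hermitian_conj_diag A : adjmx A = A ->
  exists U a, U \in unitmx /\ A = conj_diag U a.
Proof.
move=> adjA.
have hA : A \is hermsymmx.
  apply/is_hermitianmxP; rewrite expr0 scale1r -[LHS]adjA /adjmx map_trmx.
  by apply/matrixP => i j; rewrite !mxE.
exists (spectralmx A), (map_mx (@complex.Re R) (spectral_diag A)); split.
  exact: spectral_unit.
have /hermitian_normalmx/orthomx_spectralP {1}-> := hA.
rewrite /conj_diag; set D := map_mx _ _.
(* The eigenvalues of a Hermitian matrix are real, so taking real parts and embedding them back
   changes nothing. *)
suff -> : spectral_diag A = D by [].
apply/matrixP => i j; rewrite !mxE.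
by have /mxOverP/(_ i j)/RRe_real := hermitian_spectral_diag_real hA.
Qed.

Lemma conj_diagX U a n : U \in unitmx ->
  conj_diag U a ^+ n = conj_diag U (map_mx (fun x => x ^+ n) a).
Proof.
move=> Uu; elim: n => [|n IHn].
  rewrite expr0 /conj_diag.
  have -> : map_mx (real_complex R) (map_mx (fun x => x ^+ 0) a) = const_mx 1.
    by apply/matrixP => i j; rewrite !mxE expr0.
  by rewrite diag_const_mx mulmx1 mulVmx.
have conjM (D1 D2 : 'M[C]_d) :
    (invmx U *m D1 *m U) * (invmx U *m D2 *m U) = invmx U *m (D1 *m D2) *m U.
  by rewrite -[LHS]/(_ *m _) !mulmxA mulmxK.
rewrite exprSr IHn /conj_diag conjM mulmx_diag.
set D := \row_i _; set D' := map_mx _ _; suff -> : D = D' by [].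
by apply/matrixP => i j; rewrite !mxE ord1 exprSr rmorphM.
Qed.

Lemma rtr_conj_diag G U a :
  rtr G (conj_diag U a) =
  \sum_i a 0 i * complex.Re ((U *m G *m invmx U) i i).
Proof.
rewrite /rtr /conj_diag !mulmxA mxtrace_mulC !mulmxA mul_mx_diag Re_sum.
by apply: eq_bigr => i _; rewrite !mxE mulrC ReZ.
Qed.

(** Under any test matrix both sides are limits of one series, a weighted sum of the scalar
    exponential series of the eigenvalues. *)
Lemma mexp_conj_diag U a : U \in unitmx ->
  mexp (conj_diag U a) = conj_diag U (map_mx expR a).
Proof.
move=> Uu; apply: rtr_inj => G.
apply: (cvg_unique _ (@cvg_rtr_mexp R d G _)) => //.
rewrite rtr_conj_diag.
rewrite (_ : fact_series _ = fun n => \sum_i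
    series (exp_coeff (a 0 i)) n * complex.Re ((U *m G *m invmx U) i i)).
  apply: cvg_sum_fin => i; apply: cvgMl; rewrite mxE.
  exact: is_cvg_series_exp_coeff.
apply/funext => n; rewrite /fact_series /series/=.
under [RHS]eq_bigr do rewrite mulr_suml.
rewrite exchange_big/=; apply: eq_bigr => m _.
rewrite conj_diagX// rtr_conj_diag mulr_suml.
by apply: eq_bigr => i _; rewrite mxE /exp_coeff/= mulrAC.
Qed.

Lemma tr_conj_diag U a : U \in unitmx ->
  \tr (conj_diag U a) = (\sum_i a 0 i)%:C%C.
Proof.
move=> Uu; rewrite mxtrace_mulC mulmxA mulmxV// mul1mx mxtrace_diag rmorph_sum.
by apply: eq_bigr => i _; rewrite mxE.
Qed.

Lemma conj_diag_addC U a (c : R) : U \in unitmx ->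
  (c%:C)%C%:M + conj_diag U a = conj_diag U (map_mx (+%R c) a).
Proof.
move=> Uu; rewrite /conj_diag.
have -> : map_mx (real_complex R) (map_mx (+%R c) a) =
    const_mx c%:C%C + map_mx (real_complex R) a.
  by apply/matrixP => i j; rewrite !mxE rmorphD.
by rewrite raddfD/= diag_const_mx mulmxDr mulmxDl scalar_mxC mulmxKV.
Qed.

Lemma conj_diagZ U a (c : R) :
  conj_diag U (map_mx ( *%R c) a) = c%:C%C *: conj_diag U a.
Proof.
rewrite /conj_diag scalemxAl scalemxAr; congr (_ *m _ *m _).
have -> : map_mx (real_complex R) (map_mx ( *%R c) a) =
    c%:C%C *: map_mx (real_complex R) a.
  by apply/matrixP => i j; rewrite !mxE rmorphM.
by rewrite linearZ.
Qed.

(** A scalar matrix shifts every eigenvalue by [c] in the same eigenbasis. *)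
Lemma mexp_addC A (c : R) : adjmx A = A ->
  mexp ((c%:C)%C%:M + A) = (expR c)%:C%C *: mexp A.
Proof.
move=> /hermitian_conj_diag[U [a [Uu ->]]].
rewrite conj_diag_addC// !mexp_conj_diag// -conj_diagZ.
congr conj_diag; apply/matrixP => i j; rewrite !mxE.
exact: expRD.
Qed.

(** The trace is a sum of exponentials of real eigenvalues, nonempty because [0 < d]. *)
Lemma tr_mexp_hermitian A : (0 < d)%N -> adjmx A = A ->
  exists2 z : R, 0 < z & \tr (mexp A) = z%:C%C.
Proof.
move=> d0 /hermitian_conj_diag[U [a [Uu ->]]].
rewrite mexp_conj_diag// tr_conj_diag//.
exists (\sum_i map_mx expR a 0 i) => //.
rewrite (bigD1 (Ordinal d0))//= ltr_pwDl//; first by rewrite mxE expR_gt0.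
by apply: sumr_ge0 => i _; rewrite mxE expR_ge0.
Qed.

End HermitianExponential.

(** * Derivatives of logarithms, row-valued maps and Jacobian entries *)

Section LnComp.
Variables (R : realType) (V : normedModType R).

Lemma differentiable_ln (x : R) : 0 < x -> differentiable (@ln R) x.
Proof.
by move=> x0; apply/derivable1_diffP; have [] := is_derive1_ln x0.
Qed.

Lemma differentiable_ln_comp (f : V -> R) x :
  differentiable f x -> 0 < f x -> differentiable (fun y => ln (f y)) x.
Proof.
by move=> fx f0; apply: differentiable_comp => //; exact: differentiable_ln.
Qed.

Lemma derive_ln_comp (f : V -> R) x v :
  differentiable f x -> 0 < f x ->
  'D_v (fun y => ln (f y)) x = (f x)^-1 * 'D_v f x.
Proof.
move=> fx f0; have lnx := differentiable_ln f0.
rewrite !deriveE//; last exact: differentiable_comp.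
rewrite -[fun y => _]/(@ln R \o f) diff_comp//=.
rewrite diff1E// /= derive1E; have [_ ->] := is_derive1_ln f0.
by rewrite mulrC.
Qed.

Lemma differentiable_row k (f : 'I_k -> V -> R) x :
  (forall j, differentiable (f j) x) ->
  differentiable (fun y => \row_j f j y : 'rV[R]_k) x.
Proof.
move=> fx; rewrite (_ : (fun y => _) =
    \sum_j (fun y => f j y *: (delta_mx 0 j : 'rV[R]_k))).
  by apply: differentiable_sum => j; exact: differentiableZl.
apply/funext => y; rewrite fct_sumE [LHS]row_sum_delta.
by apply: eq_bigr => j _; rewrite mxE.
Qed.

Lemma jacobian_entry k m (f : 'rV[R]_k -> 'rV[R]_m) x i j :
  differentiable f x ->
  jacobian f x i j = 'D_(delta_mx 0 i) (fun y => f y 0 j) x.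
Proof.
move=> fx; rewrite /jacobian !mxE -deriveE//.
by rewrite derive_mx ?mxE//; exact: diff_derivable.
Qed.

End LnComp.

(** * Differentiability of the tested exponential in the parameters *)

Section ExponentialDifferential.
Local Open Scope classical_set_scope.
Variables (R : realType) (d k : nat) (F : 'I_k -> 'M[R[i]]_d).
Implicit Types (mu h : 'rV[R]_k) (G : 'M[R[i]]_d).

Lemma lincombD mu h : lincomb (mu + h) F = lincomb mu F + lincomb h F.
Proof.
rewrite /lincomb -big_split/=; apply: eq_bigr => j _.
by rewrite mxE rmorphD scalerDl.
Qed.

Lemma nrm_lincomb h : nrm (lincomb h F) <= `|h| * \sum_j nrm (F j).
Proof.
rewrite mulr_sumr.
apply: (big_ind2 (fun A x => nrm A <= x)) => [|A x B y Ax By|j _].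
- by rewrite nrm0.
- by apply: le_trans (nrmD _ _) _; exact: lerD.
- rewrite nrmZ ler_wpM2r ?nrm_ge0//.
  (* The norm on rows is the maximum norm, which dominates each coordinate. *)
  rewrite [leRHS]/Num.Def.normr/= mx_normrE.
  exact: (@le_bigmax _ _ _ 0 (fun ij => `|h ij.1 ij.2|) (0, j)).
Qed.

Definition coord_form (c : 'I_k -> R) h : R := \sum_j h 0 j * c j.

Lemma coord_form_linear c : linear (coord_form c).
Proof.
move=> a h h'; rewrite /coord_form scaler_sumr -big_split/=.
by apply: eq_bigr => j _; rewrite !mxE mulrDl -mulrA.
Qed.

HB.instance Definition _ c :=
  GRing.isLinear.Build R 'rV[R]_k R _ (coord_form c) (@coord_form_linear c).

Lemma coord_form_continuous c : continuous (coord_form c).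
Proof.
move=> h.
apply: (@cvg_sum_fin R _ (nbhs h) _ _ (fun j h' => h' 0 j * c j) _
  (nbhs_filter h)) => j.
by apply: cvgMl; exact: coord_continuous.
Qed.

(** The remainder is at most [K * S ^+ 2 * |h| ^ 2], hence negligible against [|h|]. *)
Lemma rtr_mexp_expansion G mu :
  (fun h => rtr G (mexp (lincomb h F))) \o shift mu =
  cst (rtr G (mexp (lincomb mu F))) +
  coord_form (fun j => dexp G (lincomb mu F) (F j)) +o_ (0 : 'rV[R]_k) id.
Proof.
set A := lincomb mu F.
pose S := \sum_j nrm (F j).
have S0 : 0 <= S by apply: sumr_ge0 => j _; exact: nrm_ge0.
pose K := nrm G * nrm (1 : 'M[R[i]]_d) * expR (4 * (nrm A + 1)).
have K0 : 0 <= K by rewrite !mulr_ge0 ?nrm_ge0 ?expR_ge0.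
have near0 e : 0 < e -> \forall h \near (0 : 'rV[R]_k), `|h| < e.
  exact: nbhs0_lt.
(* Adding 1 keeps the radii [(S + 1)^-1] and [e / (K * S ^+ 2 + 1)] well defined even when [S] or
   [K] is zero. *)
have S1 : 0 < S + 1 by rewrite ltr_wpDl.
have KS0 : 0 <= K * S ^+ 2 by rewrite mulr_ge0 // exprn_ge0.
have KS1 : 0 < K * S ^+ 2 + 1 by rewrite ltr_wpDl.
apply/eqaddoP => e e0; near=> h.
have hS : nrm (lincomb h F) <= `|h| * S by exact: nrm_lincomb.
have h1 : `|h| * S <= 1.
  have : `|h| < (S + 1)^-1 by near: h; apply: near0; rewrite invr_gt0.
  rewrite -[_^-1]mul1r ltr_pdivlMr// => /ltW; apply: le_trans.
  by rewrite ler_wpM2l// lerDl.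
have h2 : `|h| * (K * S ^+ 2) <= e.
  have : `|h| < e / (K * S ^+ 2 + 1) by near: h; apply: near0; rewrite divr_gt0.
  rewrite ltr_pdivlMr// => /ltW; apply: le_trans.
  by rewrite ler_wpM2l// lerDl.
have := dexp_remainder G A (le_trans hS h1).
rewrite dexp_lincomb -/(coord_form _ h) -lincombD => rem.
have remE (f g : 'rV[R]_k -> R) a :
    ((f \o shift mu) - (cst a + g)) h = f (h + mu) - a - g h.
  by rewrite !fctE /= opprD addrA.
rewrite remE [h + mu]addrC.
apply: le_trans rem _; rewrite -/K.
apply: (@le_trans _ _ (K * (`|h| * S) ^+ 2)).
  by rewrite ler_wpM2l// lerXn2r ?nnegrE ?nrm_ge0// mulr_ge0.
rewrite exprMn expr2 -[_ * `|h|]mulrC.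
rewrite [leLHS](_ : _ = `|h| * (K * S ^+ 2) * `|h|); last by ring.
by rewrite ler_wpM2r.
Unshelve. all: by end_near. Qed.

Lemma diff_rtr_mexp G mu :
  'd (fun h => rtr G (mexp (lincomb h F))) mu =
  coord_form (fun j => dexp G (lincomb mu F) (F j)) :> ('rV[R]_k -> R).
Proof.
by apply: diff_unique;
  [exact: coord_form_continuous | exact: rtr_mexp_expansion].
Qed.

Lemma differentiable_rtr_mexp G mu :
  differentiable (fun h => rtr G (mexp (lincomb h F))) mu.
Proof.
by apply/diff_locallyP; rewrite diff_rtr_mexp; split;
  [exact: coord_form_continuous | exact: rtr_mexp_expansion].
Qed.

Lemma derive_tr_mexp i mu :
  'D_(delta_mx 0 i) (fun h => rtr 1 (mexp (lincomb h F))) mu =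
  rtr (F i) (mexp (lincomb mu F)).
Proof.
rewrite deriveE; last exact: differentiable_rtr_mexp.
rewrite diff_rtr_mexp /coord_form (bigD1 i)//= big1 => [|j /negPf ji]; last first.
  by rewrite mxE ji mul0r.
by rewrite mxE !eqxx mul1r addr0 dexp_trace.
Qed.

End ExponentialDifferential.

(** * Mean values in the Gibbs state, the Hessian of the log-partition function, and the update
    map *)

Section GibbsState.
Variables (R : realType) (d k : nat) (F : 'I_k -> 'M[R[i]]_d).
Hypotheses (d_gt0 : (0 < d)%N) (F_herm : forall j, adjmx (F j) = F j).
Implicit Types (mu : 'rV[R]_k).

Lemma adjmx_lincomb mu : adjmx (lincomb mu F) = lincomb mu F.
Proof.
rewrite /lincomb /adjmx !raddf_sum; apply: eq_bigr => j _.
rewrite -[in RHS](F_herm j) /adjmx; apply/matrixP => a b.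
by rewrite !mxE -[LHS]/(conjc _) rmorphM/= oppr0.
Qed.

Lemma tr_mexp_lincomb mu : exists2 z : R, 0 < z &
  \tr (mexp (lincomb mu F)) = z%:C%C.
Proof. exact/tr_mexp_hermitian/adjmx_lincomb. Qed.

Lemma rtr1 (A : 'M[R[i]]_d) : rtr 1 A = complex.Re (\tr A).
Proof. by rewrite /rtr mul1mx. Qed.

Lemma partition_gt0 mu : 0 < rtr 1 (mexp (lincomb mu F)).
Proof. by have [z z0 zE] := tr_mexp_lincomb mu; rewrite rtr1 zE. Qed.

(** The number [p_j], written as a real quotient of two functions already known to be
    differentiable. *)
Definition mean mu j : R :=
  rtr (F j) (mexp (lincomb mu F)) / rtr 1 (mexp (lincomb mu F)).

Lemma mean_xi mu j : complex.Re (\tr (F j *m xi F mu)) = mean mu j.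
Proof.
have [z z0 zE] := tr_mexp_lincomb mu.
rewrite -/(rtr (F j) _) /xi zE /mean rtr1 zE/= -rmorphV ?unitfE ?gt_eqF//.
by rewrite rtrZ mulrC.
Qed.

(** [ln_sigma0] contributes only a nonzero scalar factor to the exponential, which cancels on
    division by the trace. *)
Lemma QIS_Y_normalized mu : (\tr (QIS_Y F mu))^-1 *: QIS_Y F mu = xi F mu.
Proof.
rewrite /QIS_Y /ln_sigma0 mexp_addC ?adjmx_lincomb// /xi mxtraceZ invfM scalerA.
rewrite mulrAC mulVf ?mul1r// -(rmorph0 (real_complex R)).
by rewrite (inj_eq (@complexI R)) gt_eqF// expR_gt0.
Qed.

Lemma hs_inner_QIS_Y mu j :
  complex.Re (hs_inner (F j) ((\tr (QIS_Y F mu))^-1 *: QIS_Y F mu)) = mean mu j.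
Proof. by rewrite QIS_Y_normalized /hs_inner F_herm mean_xi. Qed.

Lemma differentiable_mean mu j : differentiable (mean ^~ j) mu.
Proof.
apply: differentiableM; first exact: differentiable_rtr_mexp.
apply: differentiableV; first exact: differentiable_rtr_mexp.
by rewrite gt_eqF// partition_gt0.
Qed.

Lemma derive_logZ mu j : 'D_(delta_mx 0 j) (logZ F) mu = mean mu j.
Proof.
have -> : logZ F = fun mu => ln (rtr 1 (mexp (lincomb mu F))).
  by apply/funext => h; rewrite /logZ rtr1.
rewrite derive_ln_comp ?partition_gt0//; last exact: differentiable_rtr_mexp.
by rewrite derive_tr_mexp mulrC.
Qed.

(** The gradient formula holds at every point, so it may be substituted under the outer
    derivative. *)
Lemma hessian_logZ mu i l :
  hessian (logZ F) mu i l = 'D_(delta_mx 0 l) (mean ^~ i) mu.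
Proof.
rewrite mxE; congr ('D_ _ _ _); apply/funext => h; exact: derive_logZ.
Qed.

Lemma QIS_mapE (rho0 : 'M[R[i]]_d) :
  QIS_map F rho0 = fun mu => \row_j (mu 0 j +
    (ln (complex.Re (hs_inner (F j) rho0)) - ln (mean mu j))).
Proof.
by apply/funext => mu; apply/rowP => j; rewrite !mxE hs_inner_QIS_Y.
Qed.

Section Entry.
Variables (mu : 'rV[R]_k) (j : 'I_k) (c : R).
Hypothesis mean_gt0 : 0 < mean mu j.

Lemma differentiable_QIS_entry :
  differentiable (fun h : 'rV[R]_k => h 0 j + (c - ln (mean h j))) mu.
Proof.
apply: differentiableD; first exact: differentiable_coord.
apply: differentiableB; first exact: differentiable_cst.
by apply: differentiable_ln_comp => //; exact: differentiable_mean.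
Qed.

Lemma derive_QIS_entry l :
  'D_(delta_mx 0 l) (fun h : 'rV[R]_k => h 0 j + (c - ln (mean h j))) mu =
  (j == l)%:R - (mean mu j)^-1 * hessian (logZ F) mu j l.
Proof.
have dln : differentiable (fun h => ln (mean h j)) mu.
  by apply: differentiable_ln_comp => //; exact: differentiable_mean.
have dcoord : differentiable (fun h : 'rV[R]_k => h 0 j : R) mu.
  exact: differentiable_coord.
rewrite [LHS]deriveD; [|exact: diff_derivable|]; last first.
  apply: diff_derivable; apply: differentiableB => //.
rewrite [X in _ + X]deriveB; [|exact: derivable_cst|exact: diff_derivable].
rewrite derive_cst sub0r derive_ln_comp//; last exact: differentiable_mean.
rewrite hessian_logZ; congr (_ - _).
(* The derivative of a coordinate is that coordinate of the derivative of the identity, namely of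
   the direction itself. *)
transitivity (('D_(delta_mx 0 l) (@id 'rV[R]_k) mu) 0 j).
  by rewrite derive_mx ?mxE//; exact: derivable_id.
by rewrite derive_id mxE.
Qed.

End Entry.

End GibbsState.

(** * Inverse of the diagonal matrix of means, and assembly of the Jacobian *)

Lemma invmx_diag (K : fieldType) n (v : 'rV[K]_n) : (forall i, v 0 i != 0) ->
  invmx (diag_mx v) = diag_mx (map_mx GRing.inv v).
Proof.
move=> v0; have vV : diag_mx v *m diag_mx (map_mx GRing.inv v) = 1%:M.
  rewrite mulmx_diag -diag_const_mx; congr diag_mx.
  by apply/rowP => i; rewrite !mxE mulfV.
have [vu _] := mulmx1_unit vV.
by rewrite -[RHS](mulKmx vu) vV mulmx1.
Qed.

(* jacobian f p (MathComp-Analysis) is the matrix M with 'D_v f p = v *m M,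
   i.e. M l i = d f_i / d lambda_l; its transpose is the usual Jacobian
   J i l = d f_i / d lambda_l. *)
Theorem theorem4p1 (R : realType) (d k : nat) (F : 'I_k -> 'M[R[i]]_d)
    (rho0 : 'M[R[i]]_d) (lam : 'rV[R]_k) :
  (1 <= d)%N ->
  (forall j, psd (F j)) ->
  loewner_le (\sum_(j < k) F j) 1%:M ->
  density rho0 ->
  (forall j, 0 < complex.Re (hs_inner (F j) rho0)) ->
  (forall j, 0 < complex.Re (hs_inner (F j) ((\tr (QIS_Y F lam))^-1 *: QIS_Y F lam))) ->
  differentiable (QIS_map F rho0) lam /\
  (jacobian (QIS_map F rho0) lam)^T
    = 1%:M - invmx (QIS_P F lam) *m hessian (logZ F) lam.
Proof.
move=> d0 F_psd _ _ _ Y_gt0.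
have F_herm j : adjmx (F j) = F j by have [] := F_psd j.
(* Positivity of the means gives both differentiability of the logarithms and invertibility of
   [QIS_P]. *)
have mean_gt0 j : 0 < mean F lam j by rewrite -hs_inner_QIS_Y.
have diffQ : differentiable (QIS_map F rho0) lam.
  rewrite QIS_mapE//; apply: differentiable_row => j.
  exact: differentiable_QIS_entry.
split=> //; apply/matrixP => j l.
have -> : QIS_P F lam = diag_mx (\row_j mean F lam j).
  by congr diag_mx; apply/rowP => i; rewrite !mxE mean_xi.
rewrite invmx_diag => [|i]; last by rewrite mxE gt_eqF.
rewrite mul_diag_mx [LHS]mxE jacobian_entry// !mxE.
have -> : (fun h => QIS_map F rho0 h 0 j) = fun h => h 0 j +
    (ln (complex.Re (hs_inner (F j) rho0)) - ln (mean F h j)).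
  by apply/funext => h; rewrite QIS_mapE// mxE.
by rewrite derive_QIS_entry// [hessian _ _ _ _]mxE.
Qed.
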